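(* Every limit group has a free action on an $\mathbb{R}^n$-tree for some $n$.
   Context: Marked groups: a marked group $(G,S)$ is a finitely generated group $G$ with an ordered generating family $S=(s_1,\dots,s_k)$ (repetitions and trivial elements allowed). A relation of $(G,S)$ is an element of the kernel of the morphism $F_k\to G$, $a_i\mapsto s_i$, where $F_k$ is free on $(a_1,\dots,a_k)$. Two marked groups are isomorphic if they have the same set of relations; $\mathcal{G}_k$ is the set of isomorphism classes, with the topology in which a neighbourhood basis of $(G,S)$ is given by the sets $N_R(G,S)$ ($R>0$) of marked groups having exactly the same relations of length at most $R$ as $(G,S)$. A limit group is a (marked) group which is a limit in some $\mathcal{G}_k$ of markings of free groups (this does not depend on the chosen generating family). $\mathbb{R}^n$-trees: $\mathbb{R}^n$ carries the lexicographic order (leftmost coordinate most significant). For a totally ordered abelian group $\Lambda$, a $\Lambda$-metric space is a set $E$ with $d:E\times E\to\Lambda_{\ge 0}$ satisfying separation, symmetry and the triangle inequality. It is geodesic if any two points are joined by a geodesic segment (isometric image of a segment $[a,b]\subset\Lambda$). A $\Lambda$-tree is a geodesic $\Lambda$-metric space $T$ such that $d(x,y)+d(u,v)\le\max\{d(x,u)+d(y,v),d(x,v)+d(y,u)\}$ for all $x,y,u,v\in T$, and $d(x,y)+d(y,z)-d(x,z)\in 2\Lambda$ for all $x,y,z\in T$ (automatic for $\Lambda=\mathbb{R}^n$). Actions are by isometries; an action is free if no non-trivial element fixes a point. *)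

(* Defs.v *)
From HB Require Import structures.
From mathcomp Require Import all_boot all_order all_algebra reals.

Set Implicit Arguments.
Unset Strict Implicit.
Unset Printing Implicit Defensive.

Import Order.TTheory GRing.Theory Num.Theory.

(* The free group on an alphabet A. An element is a reduced word, stored as   *)
(* the sequence of its letters; the letter (a, true) stands for the           *)
(* generator a, and (a, false) for its inverse.                               *)
Section FreeGroup.
Variable A : choiceType.

Definition letter : Type := A * bool.

Definition linv (x : letter) : letter := (x.1, ~~ x.2).

Lemma linvK : involutive linv.
Proof. by case=> a b; rewrite /linv /= negbK. Qed.

Definition not_inv (x y : letter) : bool := y != linv x.

Definition reduced (w : seq letter) : bool := sorted not_inv w.

Record free_group : Type := FreeGroup {
  fg_word : seq letter;
  fg_word_reduced : reduced fg_word
}.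

HB.instance Definition _ := [isSub for fg_word].
HB.instance Definition _ := [Choice of free_group by <:].

Definition word_length (w : free_group) : nat := size (fg_word w).

Definition red_cons (x : letter) (w : seq letter) : seq letter :=
  if w is y :: w' then if y == linv x then w' else x :: w else [:: x].

Definition red_cat (u v : seq letter) : seq letter := foldr red_cons v u.

Lemma reduced_cons x w : reduced w -> reduced (red_cons x w).
Proof.
case: w => [|y w] //= rw; case: ifPn => [_|nyx]; first exact: path_sorted rw.
by rewrite /= /not_inv nyx.
Qed.

Lemma reduced_cat u v : reduced v -> reduced (red_cat u v).
Proof. by move=> rv; elim: u => //= x u /reduced_cons. Qed.

Lemma red_consK x w :
  reduced w -> red_cons (linv x) (red_cons x w) = w.
Proof.
case: w => [|y w] /= rw; first by rewrite linvK eqxx.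
case: eqP => [eyx|_] /=; last by rewrite linvK eqxx.
rewrite eyx in rw *; case: w rw => [|z w] //= /andP[nz _].
by move: nz; rewrite /not_inv => /negPf->.
Qed.

Lemma red_cat_cons x w v :
  reduced v -> red_cat (red_cons x w) v = red_cons x (red_cat w v).
Proof.
case: w => [|y w] //= rv; case: eqP => [->|//].
by have := red_consK (linv x) (reduced_cat w rv); rewrite linvK => ->.
Qed.

Lemma red_catA u v w : reduced w -> red_cat u (red_cat v w) = red_cat (red_cat u v) w.
Proof. by move=> rw; elim: u => //= x u IHu; rewrite red_cat_cons // IHu. Qed.

Lemma red_cat0 u : reduced u -> red_cat u [::] = u.
Proof.
elim: u => //= x u IHu ru; rewrite IHu; last exact: path_sorted ru.
by case: u {IHu} ru => //= y u /andP[/negPf-> _].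
Qed.

Definition winv (w : seq letter) : seq letter := rev (map linv w).

Lemma winvK : involutive winv.
Proof. by move=> w; rewrite /winv map_rev revK (mapK linvK). Qed.

Lemma reduced_winv w : reduced w -> reduced (winv w).
Proof.
rewrite /reduced /winv rev_sorted => rw; apply: homo_sorted rw => x y.
by apply: contra_neq => ->; rewrite !linvK.
Qed.

Lemma red_cat_winv w : reduced w -> red_cat (winv w) w = [::].
Proof.
move=> rw; suff H v : reduced v -> red_cat (winv w) (red_cat w v) = v.
  by rewrite -{2}(red_cat0 rw) H.
elim: w {rw} v => //= x w IHw v rv.
rewrite /winv /= rev_cons -cats1 /red_cat foldr_cat /= red_consK; first exact: IHw.
exact: reduced_cat.
Qed.

Definition fg_one : free_group := @FreeGroup [::] isT.
Definition fg_inv (u : free_group) : free_group :=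
  @FreeGroup (winv (fg_word u)) (reduced_winv (fg_word_reduced u)).
Definition fg_mul (u v : free_group) : free_group :=
  @FreeGroup (red_cat (fg_word u) (fg_word v)) (reduced_cat (fg_word u) (fg_word_reduced v)).

Lemma fg_mulA : associative fg_mul.
Proof. by move=> u v w; apply: val_inj; rewrite /= red_catA ?(fg_word_reduced w). Qed.

Lemma fg_mul1g : left_id fg_one fg_mul.
Proof. by move=> u; apply: val_inj. Qed.

Lemma fg_mulg1 : right_id fg_one fg_mul.
Proof. by move=> u; apply: val_inj; rewrite /= red_cat0 ?(fg_word_reduced u). Qed.

Lemma fg_mulVg : left_inverse fg_one fg_inv fg_mul.
Proof. by move=> u; apply: val_inj; rewrite /= red_cat_winv ?(fg_word_reduced u). Qed.

Lemma fg_mulgV : right_inverse fg_one fg_inv fg_mul.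
Proof.
move=> u; apply: val_inj => /=.
by rewrite -{1}(winvK (fg_word u)) red_cat_winv ?reduced_winv ?(fg_word_reduced u).
Qed.

HB.instance Definition _ :=
  isGroup.Build free_group fg_mulA fg_mul1g fg_mulg1 fg_mulVg fg_mulgV.

Definition fg_gen (a : A) : free_group := @FreeGroup [:: (a, true)] isT.

End FreeGroup.

Section FreeGroupLift.
Local Open Scope group_scope.
Variables (A : choiceType) (G : groupType) (s : A -> G).

Definition eval_letter (x : letter A) : G :=
  if x.2 then s x.1 else (s x.1)^-1.

(* The morphism from the free group on A to G that sends a to s a.            *)
Definition fg_lift (w : free_group A) : G :=
  \prod_(x <- fg_word w) eval_letter x.

Lemma fg_lift_gen a : fg_lift (fg_gen a) = s a.
Proof. by rewrite /fg_lift big_seq1. Qed.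

Lemma fg_lift_mul : {morph fg_lift : u v / u * v}.
Proof.
move=> u v; rewrite /fg_lift /=; elim: (fg_word u) => [|x w IHw] /=.
  by rewrite big_nil mul1g.
rewrite big_cons -mulgA -IHw; case: (red_cat w _) => [|y w'] /=.
  by rewrite big_seq1 big_nil mulg1.
case: eqP => [->|_]; rewrite !big_cons // mulgA /eval_letter /=.
by case: x.2; rewrite /= ?mulgV ?mulVg mul1g.
Qed.

Lemma fg_lift1 : fg_lift 1 = 1.
Proof. by rewrite /fg_lift big_nil. Qed.

HB.instance Definition _ :=
  isUMagmaMorphism.Build (free_group A) G fg_lift (fg_lift1, fg_lift_mul).

End FreeGroupLift.

Definition is_free_group (G : groupType) : Prop :=
  exists (A : choiceType) (b : A -> G), bijective (fg_lift b).

Definition generates (k : nat) (G : groupType) (s : 'I_k -> G) : Prop :=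
  forall g : G, exists w : free_group 'I_k, fg_lift s w = g.

Record marked_group (k : nat) : Type := MarkedGroup {
  carrier : groupType;
  marking : 'I_k -> carrier;
  marking_generates : generates marking
}.

Definition relation_of (k : nat) (X : marked_group k)
    (w : free_group 'I_k) : Prop :=
  fg_lift (@marking k X) w = 1%g.

(* The basic neighbourhood N_R(X). As the length of a word is a natural       *)
(* number, natural radii R define the same topology as real ones.             *)
Definition in_marked_nbhd (k : nat) (R : nat) (X Y : marked_group k) : Prop :=
  forall w : free_group 'I_k,
    (word_length w <= R)%N -> (relation_of Y w <-> relation_of X w).

(* Convergence in the space of marked groups on k generators. It only depends *)
(* on the sets of relations, hence passes to isomorphism classes; limits of   *)
(* sequences suffice since each point has the countable neighbourhood basis   *)
(* (N_R(X))_R.                                                                *)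
Definition marked_cvg (k : nat) (Y : nat -> marked_group k)
    (X : marked_group k) : Prop :=
  forall R : nat, (0 < R)%N ->
    exists N : nat, forall i : nat, (N <= i)%N -> in_marked_nbhd R X (Y i).

Definition limit_marked_group (k : nat) (X : marked_group k) : Prop :=
  exists Y : nat -> marked_group k,
    (forall i, is_free_group (carrier (Y i))) /\ marked_cvg Y X.

Definition limit_group (G : groupType) : Prop :=
  exists (k : nat) (s : 'I_k -> G) (gen_s : generates s),
    limit_marked_group (MarkedGroup gen_s).

Local Open Scope ring_scope.

(* R^n with the lexicographic order, coordinate 0 being the most significant. *)
Definition lexvec (R : realType) (n : nat) : Type := 'rV[R]_n.

Section LexVec.
Variables (R : realType) (n : nat).

HB.instance Definition _ := GRing.Zmodule.on (lexvec R n).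

Definition coords (u : lexvec R n) : n.-tuplelexi R :=
  [tuple (u : 'rV[R]_n) ord0 i | i < n].

Lemma tnth_coords u i : tnth (coords u) i = (u : 'rV[R]_n) ord0 i.
Proof. exact: tnth_mktuple. Qed.

Lemma coords_inj : injective coords.
Proof.
move=> u v e; apply/rowP => i.
by have := congr1 (fun t : n.-tuple R => tnth t i) e; rewrite !tnth_coords.
Qed.

Definition lexvec_le (u v : lexvec R n) : bool := (coords u <= coords v)%O.

Lemma lexvec_refl : reflexive lexvec_le.
Proof. by move=> u; apply: lexx. Qed.

Lemma lexvec_anti : antisymmetric lexvec_le.
Proof. by move=> u v /le_anti/coords_inj. Qed.

Lemma lexvec_trans : transitive lexvec_le.
Proof. by move=> v u w; apply: le_trans. Qed.

HB.instance Definition _ := Order.Le_isPOrder.Build ring_display (lexvec R n)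
  lexvec_refl lexvec_anti lexvec_trans.

Lemma lexvec_total : total (<=%O : rel (lexvec R n)).
Proof. by move=> u v; apply: le_total. Qed.

HB.instance Definition _ :=
  Order.POrder_isTotal.Build ring_display (lexvec R n) lexvec_total.

Lemma lexvec_ltP (u v : lexvec R n) : reflect
  (exists2 k : 'I_n,
     forall i : 'I_n, (i < k)%N -> (u : 'rV[R]_n) ord0 i = (v : 'rV[R]_n) ord0 i
     & (u : 'rV[R]_n) ord0 k < (v : 'rV[R]_n) ord0 k)
  (u < v).
Proof.
have -> : (u < v) = (coords u < coords v)%O.
  by rewrite !lt_neqAle (inj_eq coords_inj).
apply: (iffP ltxi_tuplePlt) => -[k eqk ltk]; exists k.
- by move=> i /eqk; rewrite !tnth_coords.
- by move: ltk; rewrite !tnth_coords.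
- by move=> i /eqk; rewrite !tnth_coords.
- by rewrite !tnth_coords.
Qed.

Lemma lexvec_le_translate (z x y : lexvec R n) : x <= y -> x + z <= y + z.
Proof.
rewrite !le_eqVlt => /predU1P[->|/lexvec_ltP[k eqk ltk]]; first by rewrite eqxx.
apply/orP; right; apply/lexvec_ltP; exists k => [i /eqk e|].
  by rewrite !mxE e.
by rewrite !mxE ltrD2r.
Qed.

End LexVec.

(* The notions below are meant for a totally ordered abelian group L; the     *)
(* structure porderZmodType does not itself include totality or               *)
(* translation-invariance of the order, which hold for lexvec R n by          *)
(* lexvec_total and lexvec_le_translate.                                      *)
Section LambdaTrees.
Variables (L : porderZmodType) (E : Type) (d : E -> E -> L).

Definition lambda_metric : Prop :=
  [/\ forall x y, 0 <= d x y,
      forall x y, d x y = 0 <-> x = y,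
      forall x y, d x y = d y x
    & forall x y z, d x z <= d x y + d y z].

(* gamma restricts to an isometry from the segment [a, b] of L onto a         *)
(* geodesic segment from x to y; its values off [a, b] are irrelevant.        *)
Definition geodesic_segment (a b : L) (gamma : L -> E) (x y : E) : Prop :=
  [/\ a <= b, gamma a = x, gamma b = y
    & forall s t, a <= s <= b -> a <= t <= b ->
        d (gamma s) (gamma t) = Order.max (s - t) (t - s)].

Definition geodesic : Prop :=
  forall x y, exists (a b : L) (gamma : L -> E), geodesic_segment a b gamma x y.

(* The empty space is excluded: every group would act freely on it.           *)
Definition lambda_tree : Prop :=
  [/\ inhabited E, lambda_metric, geodesic,
      forall x y u v,
        d x y + d u v <= Order.max (d x u + d y v) (d x v + d y u)
    & forall x y z, exists l : L, d x y + d y z - d x z = l *+ 2].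

Definition isometric_action (G : groupType) (act : G -> E -> E) : Prop :=
  [/\ forall x, act 1%g x = x,
      forall g h x, act (g * h)%g x = act g (act h x)
    & forall g x y, d (act g x) (act g y) = d x y].

End LambdaTrees.

Definition free_action (G : groupType) (E : Type) (act : G -> E -> E) : Prop :=
  forall (g : G) (x : E), act g x = x -> g = 1%g.

(* Main.v *)
Require Import Defs.
From mathcomp Require Import all_boot all_order all_algebra reals.
From mathcomp Require Import boolp classical_sets filter topology normedtype.
From mathcomp Require Import ring lra zify.

(** Let [G], marked by [s], be a limit of the free groups [Y i]. An ultrafilter [U]
    on [nat] that contains the cofinite sets turns the word lengths of the [Y i]
    into one length on [G], with values in the ultrapower of [R]: the length of
    [g] is the class of the sequence of the lengths of [g] read in [Y i]. Each
    word length is 0-hyperbolic and satisfies [|g| < |g * g|] for [g <> 1]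
    ([word_length_four], [word_length_square]), and these inequalities pass to
    the ultrapower. What remains is to bring the values down to some [R^n] and to
    build a tree on which [G] acts.

    The values span a space of finite dimension ([length_relation]). A free group
    embeds into SL_2(Q[t]) by a ping-pong in which the degree of the matrix of a
    reduced word is the length of the word. If [k] elements generate the
    subgroup, the matrix entries of all its elements are polynomials in the [4k]
    entries of the generators. Among products of [4k + 1] such entries with
    bounded exponents there are more products than monomials available to express
    them, so the products are linearly dependent and two of them have the same
    degree: this is an integer relation between [4k + 1] lengths. Its
    coefficients are bounded independently of the free group, so one relation
    holds for [U]-almost all [i].

    A finite-dimensional space of sequences, ordered by their signs along [U],
    embeds into a lexicographic [R^n] ([ultra_sign], [lex_embedding]): the first
    coordinate is the limit along [U] of the sequence divided by the dominant
    basis sequence, and the remainder has one basis sequence fewer.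

    This gives a left-invariant 0-hyperbolic distance on [G] with values in [R^n].
    Its hull, made of the functions that look like the distance to a point of a
    tree containing [G], is an [R^n]-tree ([hull_tree]) on which [G] acts. An
    element [g] that fixes a point would satisfy [d x (g * g * x) <= d x (g * x)]
    for all [x], which the inequality [|g| < |g * g|] excludes
    ([hull_act_free]). *)

Set Implicit Arguments.
Unset Strict Implicit.
Unset Printing Implicit Defensive.

Import Order.TTheory GRing.Theory Num.Theory numFieldNormedType.Exports.

Local Open Scope ring_scope.

(** * Hulls of 0-hyperbolic lexicographic metrics *)

(** Identities in the abelian group [lexvec R n] are checked on coordinates. *)
Ltac lexring := apply/rowP => ?; rewrite !mxE; ring.

Section LexArithmetic.
Variables (R : realType) (n : nat).
Implicit Types a b x y z : lexvec R n.

Lemma lex_subr_ge0 x y : (0 <= y - x) = (x <= y).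
Proof.
apply/idP/idP => [/(lexvec_le_translate x)|/(lexvec_le_translate (- x))].
  by rewrite add0r subrK.
by rewrite subrr.
Qed.

Lemma lex_addr_ge0 x y : 0 <= x -> 0 <= y -> 0 <= x + y.
Proof.
by move=> x0 y0; apply: (le_trans y0); have := lexvec_le_translate y x0; rewrite add0r.
Qed.

(** This lemma and its variants for two and three hypotheses replace linear
    arithmetic in an ordered abelian group: an inequality follows from others as
    soon as [y - x] is the sum of their slacks. *)
Lemma lex_le1 x y x1 y1 : y - x = y1 - x1 -> x1 <= y1 -> x <= y.
Proof. by rewrite -!(lex_subr_ge0 x) -(lex_subr_ge0 x1) => ->. Qed.

Lemma lex_le2 x y x1 y1 x2 y2 : y - x = (y1 - x1) + (y2 - x2) ->
  x1 <= y1 -> x2 <= y2 -> x <= y.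
Proof.
rewrite -!(lex_subr_ge0 x) -(lex_subr_ge0 x1) -(lex_subr_ge0 x2) => ->.
exact: lex_addr_ge0.
Qed.

Lemma lex_le3 x y x1 y1 x2 y2 x3 y3 :
  y - x = (y1 - x1) + (y2 - x2) + (y3 - x3) ->
  x1 <= y1 -> x2 <= y2 -> x3 <= y3 -> x <= y.
Proof.
move=> e l1 l2 l3; apply: (lex_le2 (x1 := x1 + x2) (y1 := y1 + y2) _ _ l3).
  by rewrite e; lexring.
by apply: (lex_le2 _ l1 l2); lexring.
Qed.

Lemma lex_half_ge0 x : 0 <= x *+ 2 -> 0 <= x.
Proof.
move=> x2; case: (@leP _ (lexvec R n) 0 x) => // xlt; have xle := ltW xlt.
have : x *+ 2 <= x by apply: (lex_le1 _ xle); lexring.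
by move/(le_trans x2); rewrite leNgt xlt.
Qed.

End LexArithmetic.

Section Hull.
Variables (R : realType) (n : nat) (X : Type) (d : X -> X -> lexvec R n).

(** The four-point inequality is a disjunction instead of a bound by a maximum, so
    that each of its uses starts with the case distinction that it needs. *)
Record zero_hyperbolic : Prop := ZeroHyperbolic {
  zh_refl : forall x, d x x = 0;
  zh_sym : forall x y, d x y = d y x;
  zh_four : forall x y u v,
    d x y + d u v <= d x u + d y v \/ d x y + d u v <= d x v + d y u
}.

Hypothesis hyp : zero_hyperbolic.
Let dxx := zh_refl hyp.
Let dC := zh_sym hyp.

Lemma zh_triangle x y z : d x z <= d x y + d y z.
Proof.
by case: (zh_four hyp x z y y); rewrite dxx addr0 (dC z y).
Qed.

(** A point [p] of a tree that [X] spans is determined by its distances to the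
    points of [X]. The functions that arise are those for which the triangle
    inequality through [p] holds, and for which every [x] has some [y] with [p]
    on the segment from [x] to [y]. Requiring that [y] be attained, and not only
    approached, makes up for the incompleteness of the order of [lexvec R n]. *)
Record hull : Type := Hull {
  hull_dist :> X -> lexvec R n;
  hull_ge : forall x y, d x y <= hull_dist x + hull_dist y;
  hull_attained : forall x, exists y, hull_dist x + hull_dist y = d x y
}.

Implicit Types p q u v : hull.

Lemma hull_eq p q : p =1 q -> p = q.
Proof.
case: p q => [f f1 f2] [g g1 g2] /= /funext e.
by rewrite e in f1 f2 *; congr Hull; apply: Prop_irrelevance.
Qed.

Lemma hull_ge0 p x : 0 <= p x.
Proof. by apply: lex_half_ge0; rewrite -(dxx x) mulr2n hull_ge. Qed.

(** If [p] lies on the segment from [x] to [y], then leaving [p] means moving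
    away from [x] or from [y], and no distance varies faster than that one. *)
Lemma hull_dev p q x y z : p x + p y = d x y ->
  p z - q z <= Order.max (q x - p x) (q y - p y) /\
  q z - p z <= Order.max (q x - p x) (q y - p y).
Proof.
move=> pxy; rewrite !le_max; split.
  have [w pw] := hull_attained p z.
  have pxw := hull_ge p x w; have pyw := hull_ge p y w.
  case: (zh_four hyp z w x y) => le4; apply/orP; [left|right].
    by apply: (lex_le3 _ le4 pyw (hull_ge q z x)); rewrite -pxy -pw (dC w y); lexring.
  by apply: (lex_le3 _ le4 pxw (hull_ge q z y)); rewrite -pxy -pw (dC w x); lexring.
have [w qw] := hull_attained q z.
case: (zh_four hyp z w x y) => le4; apply/orP; [right|left].
  apply: (lex_le3 _ le4 (hull_ge p z x) (hull_ge q w y)).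
  by rewrite -pxy -qw; lexring.
apply: (lex_le3 _ le4 (hull_ge p z y) (hull_ge q w x)).
by rewrite -pxy -qw; lexring.
Qed.

(** The distance of [p] and [q] is the supremum of the differences of their
    distances to [X]. Suprema need not exist in [lexvec R n], but this one is
    attained at an end of a segment through [p], by [hull_dev]. *)
Definition is_hull_metric p q (m : lexvec R n) : Prop :=
  [/\ forall z, p z - q z <= m, forall z, q z - p z <= m
    & exists z, q z - p z = m].

Variable x0 : X.

Lemma hull_metric_exists p q : exists m, is_hull_metric p q m.
Proof.
have [y0 pxy] := hull_attained p x0.
exists (Order.max (q x0 - p x0) (q y0 - p y0)); split.
- by move=> z; have [] := hull_dev q z pxy.
- by move=> z; have [] := hull_dev q z pxy.
- by case: leP => _; [exists y0 | exists x0].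
Qed.

Definition hull_metric p q : lexvec R n := projT1 (cid (hull_metric_exists p q)).

Lemma hull_metricP p q : is_hull_metric p q (hull_metric p q).
Proof. exact: projT2 (cid (hull_metric_exists p q)). Qed.

Lemma hull_metric_uniq p q m m' :
  is_hull_metric p q m -> is_hull_metric p q m' -> m = m'.
Proof.
move=> [_ le1 [z1 e1]] [_ le2 [z2 e2]].
by apply/le_anti; rewrite -{1}e1 -{2}e2 le2 le1.
Qed.

Lemma hull_metric_sym p q : hull_metric p q = hull_metric q p.
Proof.
have [pq qp [z ez]] := hull_metricP p q; have [pq' qp' [w ew]] := hull_metricP q p.
by apply/le_anti; rewrite -{1}ez -{2}ew pq' pq.
Qed.

(** Any segment of the hull extends to a segment with ends in [X]. This reduces
    the four-point inequality and the geodesics of the hull to those of [X]. *)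
Lemma hull_metric_span p q :
  exists z w, d z w = p z + hull_metric p q + q w.
Proof.
have [_ _ [z ez]] := hull_metricP p q; have [w qzw] := hull_attained q z.
by exists z, w; rewrite -ez -qzw; lexring.
Qed.

Lemma hull_metric_le p q z : q z <= p z + hull_metric p q.
Proof.
by have [_ qp _] := hull_metricP p q; apply: (lex_le1 _ (qp z)); lexring.
Qed.

Lemma hull_lambda_metric : lambda_metric hull_metric.
Proof.
split=> [p q|p q||p q r].
- have [pq qp [z ez]] := hull_metricP p q.
  by apply: lex_half_ge0; apply: (lex_le2 _ (pq z) (qp z)); lexring.
- split=> [e|->].
    apply: hull_eq => z; have [pq qp _] := hull_metricP p q.
    have := pq z; have := qp z; rewrite e => l1 l2; apply/le_anti/andP; split.
      by apply: (lex_le1 _ l2); lexring.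
    by apply: (lex_le1 _ l1); lexring.
  by have [_ _ [z <-]] := hull_metricP q q; rewrite subrr.
- exact: hull_metric_sym.
- have [_ _ [z <-]] := hull_metricP p r.
  have [_ l1 _] := hull_metricP p q; have [_ l2 _] := hull_metricP q r.
  by apply: (lex_le2 _ (l1 z) (l2 z)); lexring.
Qed.

Lemma hull_four p q u v :
  hull_metric p q + hull_metric u v <=
  Order.max (hull_metric p u + hull_metric q v) (hull_metric p v + hull_metric q u).
Proof.
have [z [z' ez]] := hull_metric_span p q; have [w [w' ew]] := hull_metric_span u v.
rewrite le_max; apply/orP; case: (zh_four hyp z z' w w'); rewrite ez ew => le4;
  [left|right].
- have l1 : d z w <= p z + hull_metric p u + u w.
    apply: (lex_le2 _ (hull_ge u z w) (hull_metric_le p u z)); lexring.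
  have l2 : d z' w' <= q z' + hull_metric q v + v w'.
    apply: (lex_le2 _ (hull_ge v z' w') (hull_metric_le q v z')); lexring.
  by apply: (lex_le3 _ le4 l1 l2); lexring.
- have l1 : d z w' <= p z + hull_metric p v + v w'.
    apply: (lex_le2 _ (hull_ge v z w') (hull_metric_le p v z)); lexring.
  have l2 : d z' w <= q z' + hull_metric q u + u w.
    apply: (lex_le2 _ (hull_ge u z' w) (hull_metric_le q u z')); lexring.
  by apply: (lex_le3 _ le4 l1 l2); lexring.
Qed.

(** The distance from [k] to the point at distance [t] from [z] on the segment
    from [z] to [w], as it is in any tree. *)
Definition seg_fun (z w : X) (t : lexvec R n) (k : X) : lexvec R n :=
  Order.max (d k z - t) (d k w - (d z w - t)).

Lemma seg_fun_ge z w t x y : d x y <= seg_fun z w t x + seg_fun z w t y.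
Proof.
have lel k : d k z - t <= seg_fun z w t k by rewrite le_max lexx.
have ler k : d k w - (d z w - t) <= seg_fun z w t k by rewrite le_max lexx orbT.
case: (zh_four hyp x y z w) => le4.
  by apply: (lex_le3 _ le4 (lel x) (ler y)); lexring.
by apply: (lex_le3 _ le4 (ler x) (lel y)); lexring.
Qed.

Lemma seg_fun_l z w t : 0 <= t -> seg_fun z w t z = t.
Proof.
move=> t0; rewrite /seg_fun dxx; have -> : d z w - (d z w - t) = t by lexring.
apply: max_r.
by apply: (lex_le2 _ t0 t0); lexring.
Qed.

Lemma seg_fun_r z w t : t <= d z w -> seg_fun z w t w = d z w - t.
Proof.
move=> t1; rewrite /seg_fun dxx (dC w z); apply: max_l.
by apply: (lex_le2 _ t1 t1); lexring.
Qed.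

Lemma seg_fun_attained z w t : 0 <= t <= d z w ->
  forall x, exists y, seg_fun z w t x + seg_fun z w t y = d x y.
Proof.
move=> /andP[t0 t1] x.
case: (@leP _ (lexvec R n) (d x z - t) (d x w - (d z w - t)))
  => [/max_r|/ltW/max_l] e.
  by exists w; rewrite seg_fun_r // /seg_fun e subrK.
by exists z; rewrite seg_fun_l // /seg_fun e subrK.
Qed.

Definition seg_point z w t (h : 0 <= t <= d z w) : hull :=
  Hull (seg_fun_ge z w t) (seg_fun_attained h).

(** A point of the hull is determined by any segment through it and its position
    on that segment. *)
Lemma seg_point_eq z w t (h : 0 <= t <= d z w) p :
  p z = t -> p w = d z w - t -> seg_point h = p.
Proof.
move=> pz pw; apply: hull_eq => k; apply/le_anti/andP; split.
  rewrite /= /seg_fun -pw -pz ge_max.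
  apply/andP; split; [move: (hull_ge p k z)|move: (hull_ge p k w)].
    by move=> l; apply: (lex_le1 _ l); lexring.
  by move=> l; apply: (lex_le1 _ l); lexring.
have [k' pk] := hull_attained p k.
rewrite /= /seg_fun -pw -pz le_max; apply/orP.
have e : d z w = p z + p w by rewrite pw pz; lexring.
case: (zh_four hyp k k' z w) => le4; [left|right].
  by apply: (lex_le2 _ le4 (hull_ge p k' w)); rewrite e -pk; lexring.
by apply: (lex_le2 _ le4 (hull_ge p k' z)); rewrite e -pk; lexring.
Qed.

Lemma seg_fun_lip z w s t k :
  seg_fun z w s k - seg_fun z w t k <= Order.max (s - t) (t - s).
Proof.
have ll : t - s <= Order.max (s - t) (t - s) by rewrite le_max lexx orbT.
have lr : s - t <= Order.max (s - t) (t - s) by rewrite le_max lexx.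
set M := Order.max (s - t) _ in ll lr *.
rewrite {1}/seg_fun.
have lel : d k z - t <= seg_fun z w t k by rewrite le_max lexx.
have ler : d k w - (d z w - t) <= seg_fun z w t k by rewrite le_max lexx orbT.
case: (@leP _ (lexvec R n) (d k z - s) (d k w - (d z w - s))) => _.
  by apply: (lex_le2 _ ler lr); lexring.
by apply: (lex_le2 _ lel ll); lexring.
Qed.

Lemma seg_point_metric z w s t (hs : 0 <= s <= d z w) (ht : 0 <= t <= d z w) :
  hull_metric (seg_point hs) (seg_point ht) = Order.max (s - t) (t - s).
Proof.
apply: hull_metric_uniq (hull_metricP _ _) _; split=> [k|k|].
- exact: seg_fun_lip.
- by rewrite maxC; exact: seg_fun_lip.
- have [s0 s1] := andP hs; have [t0 t1] := andP ht.
  case: (@leP _ (lexvec R n) (s - t) (t - s)) => _; [exists z | exists w] => /=.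
    by rewrite !seg_fun_l.
  by rewrite !seg_fun_r //; lexring.
Qed.

Lemma hull_geodesic : geodesic hull_metric.
Proof.
move=> p q; have [z [w ezw]] := hull_metric_span p q.
set D := hull_metric p q in ezw.
have D0 : 0 <= D by have [+ _ _ _] := hull_lambda_metric; apply.
have qz : q z = p z + D.
  apply/le_anti; rewrite hull_metric_le.
  by apply: (lex_le1 _ (hull_ge q z w)); rewrite ezw; lexring.
have pw : p w = d z w - p z.
  apply/le_anti/andP; split.
    have := hull_metric_le q p w; rewrite hull_metric_sym -/D => l.
    by apply: (lex_le1 _ l); rewrite ezw; lexring.
  by apply: (lex_le1 _ (hull_ge p z w)); lexring.
have in_seg t : p z <= t <= p z + D -> 0 <= t <= d z w.
  move=> /andP[t0 t1]; rewrite (le_trans (hull_ge0 p z) t0) (le_trans t1) // ezw.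
  by apply: (lex_le1 _ (hull_ge0 q w)); lexring.
have pzD : p z <= p z + D by apply: (lex_le1 _ D0); lexring.
have hp : p z <= p z <= p z + D by rewrite lexx.
have hq : p z <= p z + D <= p z + D by rewrite lexx pzD.
(* Off the segment the value of the parametrization does not matter. *)
pose gam t := if pselect (0 <= t <= d z w) is left h then seg_point h else p.
exists (p z), (p z + D), gam; split => //.
- by rewrite /gam; case: pselect => [h|/(_ (in_seg _ hp))//]; apply: seg_point_eq.
- rewrite /gam; case: pselect => [h|/(_ (in_seg _ hq))//]; apply: seg_point_eq => //.
  by rewrite ezw; lexring.
- move=> s t /in_seg hs /in_seg ht; rewrite /gam.
  by case: pselect => // hs'; case: pselect => // ht'; rewrite seg_point_metric.
Qed.

Lemma hull_tree : lambda_tree hull_metric.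
Proof.
split; [|exact: hull_lambda_metric|exact: hull_geodesic|exact: hull_four|].
  have h00 : 0 <= (0 : lexvec R n) <= d x0 x0 by rewrite dxx lexx.
  exact: inhabits (seg_point h00).
move=> p q r; set s := _ - _; exists (2^-1 *: (s : 'rV[R]_n)).
by apply/rowP => i; rewrite !mxE; field.
Qed.

End Hull.

Section HullAction.
Variables (R : realType) (n : nat) (G : groupType) (X : Type).
Variables (d : X -> X -> lexvec R n) (act : G -> X -> X).
Hypotheses (hyp : zero_hyperbolic d) (isom : isometric_action d act).

Let act1 : forall x, act 1%g x = x. Proof. by case: isom. Qed.
Let actM : forall g h x, act (g * h)%g x = act g (act h x). Proof. by case: isom. Qed.
Let act_d : forall g x y, d (act g x) (act g y) = d x y. Proof. by case: isom. Qed.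

Let actKV g x : act g (act g^-1%g x) = x.
Proof. by rewrite -actM mulgV act1. Qed.

Lemma hull_act_ge g (p : hull d) x y :
  d x y <= p (act g^-1%g x) + p (act g^-1%g y).
Proof. by rewrite -(act_d g^-1%g) hull_ge. Qed.

Lemma hull_act_attained g (p : hull d) x :
  exists y, p (act g^-1%g x) + p (act g^-1%g y) = d x y.
Proof.
have [y e] := hull_attained p (act g^-1%g x); exists (act g y).
by rewrite -actM mulVg act1 e -(act_d g) actKV.
Qed.

Definition hull_act (g : G) (p : hull d) : hull d :=
  Hull (hull_act_ge g p) (hull_act_attained g p).

Lemma hull_act_isometric (x0 : X) : isometric_action (hull_metric hyp x0) hull_act.
Proof.
split=> [p|g h p|g p q].
- by apply: hull_eq => x /=; rewrite invg1 act1.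
- by apply: hull_eq => x /=; rewrite invgM actM.
- apply: hull_metric_uniq (hull_metricP _ _ _ _) _.
  have [pq qp [z ez]] := hull_metricP hyp x0 p q; split=> [y|y|] /=.
  + exact: pq.
  + exact: qp.
  + by exists (act g z); rewrite -actM mulVg act1.
Qed.

(** If [g] fixes [p], then [x], [g x] and [g (g x)] are at the same distance from
    [p]. Choose [y] with [p] between [g x] and [y]; the four-point inequality
    for [x], [g (g x)], [g x], [y] then bounds [d x (g (g x))] by [d x (g x)]. *)
Lemma hull_act_free :
  (forall g, g <> 1%g -> exists x, d x (act g x) < d x (act g (act g x))) ->
  free_action hull_act.
Proof.
move=> hypb g p gp; apply: contrapT => /hypb[x]; apply/negP; rewrite -leNgt.
have fixp y : p (act g y) = p y.
  by rewrite -{1}gp /= -actM mulVg act1.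
have [y ey] := hull_attained p (act g x); rewrite fixp in ey.
have py := hull_ge p x y; have pgy := hull_ge p (act g (act g x)) y.
rewrite !fixp in pgy.
case: (zh_four hyp x (act g (act g x)) (act g x) y) => le4.
  by apply: (lex_le2 _ le4 pgy); rewrite -ey; lexring.
have e : d (act g (act g x)) (act g x) = d x (act g x) by rewrite act_d (zh_sym hyp).
by apply: (lex_le2 _ le4 py); rewrite -ey e; lexring.
Qed.

End HullAction.

(** * Word length in a free group *)

Section CommonPrefix.
Variable T : eqType.
Implicit Types u v w : seq T.

Fixpoint lcp u v : nat :=
  if u is x :: u' then
    if v is y :: v' then if x == y then (lcp u' v').+1 else 0%N else 0%N
  else 0%N.

Lemma lcpC u v : lcp u v = lcp v u.
Proof. by elim: u v => [|x u IHu] [|y v] //=; rewrite eq_sym IHu. Qed.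

(** Common prefixes are the Gromov products of the free group, and their
    ultrametric inequality is what makes the word length 0-hyperbolic. *)
Lemma lcp_ultrametric u v w : (minn (lcp u v) (lcp v w) <= lcp u w)%N.
Proof.
elim: u v w => [|x u IHu] [|y v] [|z w] //=; rewrite ?minn0 ?min0n //.
have [->|nxy] := eqVneq x y; last by rewrite min0n.
by have [_|] := eqVneq y z; [rewrite minnSS ltnS IHu | rewrite minn0].
Qed.

Lemma lcp_four x y u v :
  (minn (lcp x u + lcp y v) (lcp x v + lcp y u) <= lcp x y + lcp u v)%N.
Proof.
have := lcp_ultrametric x u y; have := lcp_ultrametric x v y.
have := lcp_ultrametric u x v; have := lcp_ultrametric u y v.
rewrite (lcpC u x) (lcpC u y) (lcpC v y); lia.
Qed.

Lemma nth_lcp x0 u v i : (i < lcp u v)%N -> nth x0 u i = nth x0 v i.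
Proof.
elim: u v i => [|x u IHu] [|y v] [|i] //=; case: eqP => // _.
by rewrite ltnS; exact: IHu.
Qed.

End CommonPrefix.

Section WordLength.
Variable A : choiceType.
Implicit Types g u v w : free_group A.

(** The letters that cancel in the product of [u^-1] and [v] are those of the
    common prefix of [u] and [v]. *)
Lemma size_red_cat_winv (u v : seq (letter A)) : reduced u -> reduced v ->
  (size (red_cat (winv u) v) + (lcp u v).*2 = size u + size v)%N.
Proof.
elim: u v => [|x u IHu] v ru rv; first by rewrite /= addn0.
have ru' := path_sorted ru.
rewrite /winv /= rev_cons -cats1 /red_cat foldr_cat /= -/(red_cat (winv u) _).
have key : reduced (linv x :: v) -> red_cons (linv x) v = linv x :: v ->
    (size (red_cat (winv u) (red_cons (linv x) v)) = (size u).+1 + size v)%N.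
  move=> rv' ->; have := IHu _ ru' rv'.
  have -> : lcp u (linv x :: v) = 0%N.
    by case: (u) ru => [|y u'] //= /andP[/negPf->].
  by rewrite addn0 => -> /=; rewrite addnS addSn.
case: v rv key => [_ key|y v rv key].
  by rewrite key // addn0.
have [exy|nxy] := eqVneq x y.
  rewrite -exy /= linvK eqxx doubleS.
  have := IHu _ ru' (path_sorted rv); lia.
rewrite key ?addn0 //.
- by move: rv; rewrite /reduced /= /not_inv linvK eq_sym nxy.
- by rewrite /= linvK eq_sym (negPf nxy).
Qed.

Lemma word_length_mulVg u v :
  (word_length (u^-1 * v)%g + (lcp (fg_word u) (fg_word v)).*2 =
   word_length u + word_length v)%N.
Proof. exact: size_red_cat_winv (fg_word_reduced u) (fg_word_reduced v). Qed.

Lemma word_lengthV u : word_length (u^-1)%g = word_length u.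
Proof. by rewrite /word_length /= /winv size_rev size_map. Qed.

Lemma word_length_four x y u v :
  (word_length (x^-1 * y)%g + word_length (u^-1 * v)%g <=
     word_length (x^-1 * u)%g + word_length (y^-1 * v)%g)%N \/
  (word_length (x^-1 * y)%g + word_length (u^-1 * v)%g <=
     word_length (x^-1 * v)%g + word_length (y^-1 * u)%g)%N.
Proof.
have := word_length_mulVg x y; have := word_length_mulVg u v.
have := word_length_mulVg x u; have := word_length_mulVg y v.
have := word_length_mulVg x v; have := word_length_mulVg y u.
have := lcp_four (fg_word x) (fg_word y) (fg_word u) (fg_word v).
lia.
Qed.

(** Otherwise [g] and [g^-1] share a prefix of at least half their length, so the
    [i]-th letter of [g] is inverse to the [i]-th letter from the end, up to the
    middle. The middle letter would then be its own inverse, or the two middle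
    letters would cancel. *)
Lemma word_length_square g : g <> 1%g -> (word_length g < word_length (g * g)%g)%N.
Proof.
move=> g1; set m := lcp (fg_word g^-1%g) (fg_word g).
have e : (word_length (g * g)%g + m.*2 = word_length g + word_length g)%N.
  by have := word_length_mulVg g^-1%g g; rewrite invgK word_lengthV.
suff : (m.*2 < word_length g)%N by lia.
rewrite ltnNge; apply/negP => le_lcp.
have := fg_word_reduced g; have : fg_word g != [::].
  by apply: contra_notN g1 => /eqP g1; apply: val_inj.
move: le_lcp; rewrite /m /word_length [fg_word _^-1%g]/=.
case: (fg_word g) => // x0 w'; set w := x0 :: w' => le_lcp _ rw.
have w0 : (0 < size w)%N by [].
have mirror i : (i < lcp (winv w) w)%N -> (i < size w)%N ->
    nth x0 w i = linv (nth x0 w (size w - i.+1)).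
  move=> im iw; rewrite -(nth_lcp x0 im) /winv nth_rev size_map //.
  by rewrite (nth_map x0) // ltn_subrL.
have := odd_double_half (size w); case: (boolP (odd (size w))) => _ half.
- have lt1 : ((size w)./2 < lcp (winv w) w)%N by lia.
  have lt2 : ((size w)./2 < size w)%N by lia.
  have := congr1 snd (mirror _ lt1 lt2).
  have -> : (size w - (size w)./2.+1 = (size w)./2)%N by lia.
  by case: (nth _ _ _) => a [].
- have ltw : ((size w)./2.-1.+1 < size w)%N by lia.
  have := mirror (size w)./2.-1.
  have -> : (size w - (size w)./2.-1.+1 = (size w)./2.-1.+1)%N by lia.
  move=> H; have := sortedP x0 rw _ ltw; rewrite H ?/not_inv ?linvK ?eqxx //; lia.
Qed.

End WordLength.

(** * Degrees of polynomials with few generators *)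

Section MonomialSpan.
Variables (F : fieldType) (C : finType) (y : C -> {poly F}).

(** The exponents are bounded variable by variable, which makes the number of
    available monomials a plain power. *)
Definition in_span (D : nat) (p : {poly F}) : Prop :=
  exists c : {ffun C -> 'I_D.+1} -> F, p = \sum_a c a *: \prod_i y i ^+ a i.

Lemma in_span_monomial D (a : C -> nat) : (forall i, a i <= D)%N ->
  in_span D (\prod_i y i ^+ a i).
Proof.
move=> aD; exists (fun b => (b == [ffun i => inord (a i)])%:R).
rewrite (bigD1 [ffun i => inord (a i)]) //= eqxx scale1r [X in _ + X]big1 ?addr0 => [|b /negPf->].
  by apply: eq_bigr => i _; rewrite ffunE inordK // ltnS.
by rewrite scale0r.
Qed.

Lemma in_span0 D : in_span D 0.
Proof. by exists (fun=> 0); rewrite big1 // => a _; rewrite scale0r. Qed.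

Lemma in_spanD D p q : in_span D p -> in_span D q -> in_span D (p + q).
Proof.
move=> [c ->] [c' ->]; exists (fun a => c a + c' a).
by rewrite -big_split; apply: eq_bigr => a _; rewrite scalerDl.
Qed.

Lemma in_spanZ D k p : in_span D p -> in_span D (k *: p).
Proof.
move=> [c ->]; exists (fun a => k * c a).
by rewrite scaler_sumr; apply: eq_bigr => a _; rewrite scalerA.
Qed.

Lemma in_span_sum D (I : Type) (r : seq I) (P : pred I) (E : I -> {poly F}) :
  (forall i, P i -> in_span D (E i)) -> in_span D (\sum_(i <- r | P i) E i).
Proof.
by move=> sE; apply: big_ind => //; [apply: in_span0 | apply: in_spanD].
Qed.

Lemma in_span_mul D D' p q : in_span D p -> in_span D' q -> in_span (D + D') (p * q).
Proof.
move=> [c ->] [c' ->]; rewrite mulr_suml; apply: in_span_sum => a _.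
rewrite mulr_sumr; apply: in_span_sum => b _.
rewrite -scalerAl -scalerAr; do 2![apply: in_spanZ]; rewrite -big_split /=.
under eq_bigr => i _ do rewrite -exprD.
by apply: in_span_monomial => i; rewrite leq_add // -ltnS.
Qed.

Lemma in_span_widen D D' p : (D <= D')%N -> in_span D p -> in_span D' p.
Proof.
move=> leD [c ->]; apply: in_span_sum => a _; apply: in_spanZ.
by apply: in_span_monomial => i; apply: leq_trans leD; rewrite -ltnS.
Qed.

Lemma in_span1 D : in_span D 1.
Proof.
have := @in_span_monomial D (fun=> 0%N) (fun=> leq0n _).
by rewrite big1 // => i _; rewrite expr0.
Qed.

Lemma in_span_gen i : in_span 1 (y i).
Proof.
have -> : y i = \prod_j y j ^+ (j == i).
  by rewrite (bigD1 i) //= eqxx expr1 big1 ?mulr1 // => j /negPf->.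
by apply: in_span_monomial => j; case: (j == i).
Qed.

Lemma in_spanX D p e : in_span D p -> in_span (D * e) (p ^+ e).
Proof.
move=> sp; elim: e => [|e IHe]; first by rewrite expr0; apply: in_span1.
by rewrite exprS mulnS; apply: in_span_mul.
Qed.

Lemma in_span_prod D (I : finType) (E : I -> {poly F}) :
  (forall i, in_span D (E i)) -> in_span (D * #|I|) (\prod_i E i).
Proof.
move=> sE; rewrite cardE mulnC -big_enum /=.
elim: (enum I) => [|i s IHs]; first by rewrite big_nil; apply: in_span1.
by rewrite big_cons mulSn; apply: in_span_mul.
Qed.

(** The matrix of coefficients on the monomials has more rows than columns. *)
Lemma in_span_dependent D (I : finType) (E : I -> {poly F}) :
  (forall i, in_span D (E i)) -> (D.+1 ^ #|C| < #|I|)%N ->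
  exists2 l : I -> F, exists i, l i != 0 & \sum_i l i *: E i = 0.
Proof.
move=> sE ltI; have [c Ec] := choice sE.
pose J := {ffun C -> 'I_D.+1}.
pose M : 'M[F]_(#|I|, #|J|) := \matrix_(i, j) c (enum_val i) (enum_val j).
have : kermx M != 0.
  rewrite kermx_eq0 /row_free; apply: contraL ltI => /eqP <-.
  by rewrite -leqNgt (leq_trans (rank_leq_col _)) // card_ffun card_ord.
case/rowV0Pn => v /sub_kermxP vM v0.
exists (fun i => v ord0 (enum_rank i)).
  have [j vj] : exists j, v ord0 j != 0.
    by apply/existsP; rewrite -negb_forall; apply: contra v0 => /forallP v0;
       apply/eqP/rowP => j; rewrite mxE; apply/eqP.
  by exists (enum_val j); rewrite enum_valK.
under eq_bigr => i _ do rewrite Ec scaler_sumr.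
rewrite exchange_big big1 //= => a _.
under eq_bigr => i _ do rewrite scalerA.
rewrite -scaler_suml; move/rowP: vM => /(_ (enum_rank a)); rewrite !mxE => vM.
rewrite [X in X *: _](_ : _ = 0) ?scale0r // -[RHS]vM.
rewrite (reindex (@enum_val _ I)) /=; last first.
  by exists enum_rank => i _; rewrite ?enum_valK ?enum_rankK.
by apply: eq_bigr => i _; rewrite enum_valK mxE enum_rankK.
Qed.

End MonomialSpan.

Section DegreeRelation.
Variable F : fieldType.

Lemma size_prod_exp (J : finType) (z : J -> {poly F}) (e : J -> nat) :
  (forall j, z j != 0) ->
  size (\prod_j z j ^+ e j) = (\sum_j e j * (size (z j)).-1).+1.
Proof.
move=> z0; rewrite -!big_enum /=.
suff H s : \prod_(j <- s) z j ^+ e j != 0 /\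
   size (\prod_(j <- s) z j ^+ e j) = (\sum_(j <- s) e j * (size (z j)).-1).+1.
  by case: (H (enum J)).
elim: s => [|j s [nz IHs]]; first by rewrite !big_nil size_poly1 oner_neq0.
rewrite !big_cons; have ze : z j ^+ e j != 0 by rewrite expf_neq0.
split; first by rewrite mulf_neq0.
rewrite size_mul // IHs addnS /=; have := size_exp (z j) (e j).
by move: ze; rewrite -size_poly_gt0; case: (size (z j ^+ e j)) => //= m _ ->; rewrite mulnC addSn.
Qed.

(** Otherwise the leading term of largest degree would have nothing to cancel
    with. *)
Lemma dependent_same_size (I : finType) (E : I -> {poly F}) (l : I -> F) :
  (forall i, E i != 0) -> (exists i, l i != 0) -> \sum_i l i *: E i = 0 ->
  exists i j, i != j /\ size (E i) = size (E j).
Proof.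
move=> E0 [i0 li0] sum0.
pose i := [arg max_(i > i0 | l i != 0) size (E i)].
have [li imax] : l i != 0 /\ forall j, l j != 0 -> (size (E j) <= size (E i))%N.
  by rewrite /i; case: arg_maxnP.
apply: contrapT => nex; have uniq_size j : j != i -> size (E j) <> size (E i).
  by move=> ji e; apply: nex; exists j, i.
have := congr1 (fun p : {poly F} => p`_(size (E i)).-1) sum0.
rewrite coef0 coef_sum (bigD1 i) //= big1 ?addr0 => [|j ji].
  by rewrite coefZ => /eqP; rewrite mulf_eq0 (negPf li) lead_coef_eq0 (negPf (E0 i)).
rewrite coefZ; have [->|lj] := eqVneq (l j) 0; first by rewrite mul0r.
rewrite nth_default ?mulr0 //.
rewrite -ltnS prednK ?size_poly_gt0 // ltn_neqAle imax // andbT.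
by apply/eqP/uniq_size.
Qed.

(** There are [N.+1 ^ #|J|] products of the [z j] with exponents at most [N], and
    all lie in the span of [(D * N * #|J|).+1 ^ #|C|] monomials. As [#|C| < #|J|],
    the products win for large [N], hence they are dependent. Terms of distinct
    degrees cannot cancel, so two of the products have the same degree. *)
Lemma degree_relation (C J : finType) (y : C -> {poly F}) (z : J -> {poly F}) (D N : nat) :
  (#|C| < #|J|)%N -> (N = (D * #|J|).+1 ^ #|C|)%N ->
  (forall j, in_span y D (z j)) -> (forall j, z j != 0) ->
  exists e e' : {ffun J -> 'I_N.+1}, e != e' /\
    (\sum_j e j * (size (z j)).-1 = \sum_j e' j * (size (z j)).-1)%N.
Proof.
move=> ltCJ eN sz z0.
pose E (e : {ffun J -> 'I_N.+1}) := \prod_j z j ^+ e j.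
have E0 e : E e != 0 by apply/prodf_neq0 => j _; rewrite expf_neq0.
have sE e : in_span y (D * N * #|J|) (E e).
  apply: in_span_prod => j; apply: in_span_widen (in_spanX (e j) (sz j)).
  by rewrite leq_mul2l -ltnS ltn_ord orbT.
have [|l l0 sl] := in_span_dependent sE.
  rewrite card_ffun card_ord; apply: (@leq_trans (N.+1 ^ #|C|.+1)); last exact: leq_pexp2l.
  (* With [B := (D * #|J|).+1], so that [N = B ^ #|C|], the monomials number at
     most [(B * N.+1) ^ #|C| = N * N.+1 ^ #|C|], less than [N.+1 ^ #|C|.+1]. *)
  have le1 : ((D * N * #|J|).+1 <= (D * #|J|).+1 * N.+1)%N by lia.
  apply: (@leq_ltn_trans (((D * #|J|).+1 * N.+1) ^ #|C|)).
    by case: (#|C|) => // c; rewrite leq_exp2r.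
  by rewrite expnMn -eN expnS ltn_pmul2r // expn_gt0.
have [e [e' [nee]]] := dependent_same_size E0 l0 sl.
by rewrite !size_prod_exp // => -[ee]; exists e, e'.
Qed.

End DegreeRelation.

(** * A free group of matrices whose degrees are word lengths *)

Section LetterMatrices.
Variables (A : choiceType) (pos : A -> nat).

(** Each letter gets its own point [point x] of the projective line, with inverse
    letters at consecutive integers. *)
Definition point (x : letter A) : nat := ((pos x.1).*2 + ~~ x.2)%N.

(** Put [p := point x] and [q := point (linv x)]. The matrix of [x] is a conjugate
    of [[t, 1; -1, 0]] or of its inverse by a constant matrix of determinant 1.
    Up to sign, its coefficient at ['X] is the matrix of rank 1 with image
    spanned by [(1, p)] and kernel spanned by [(1, q)]. Hence the degrees of
    two letters add up in their product exactly when the second letter is not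
    the inverse of the first. *)
Definition lmx (x : letter A) : 'M[{poly rat}]_2 :=
  let p := (point x)%:R in let q := (point (linv x))%:R in
  (-1) ^+ x.2 *: \matrix_(i, j) (
    (if i == 0 then 1 else p) * (if j == 0 then - q else 1) * 'X +
    (if i == 0 then if j == 0 then p + q else - 2
     else if j == 0 then p ^+ 2 + q ^+ 2 else - (p + q))).

Definition wmx (w : seq (letter A)) : 'M[{poly rat}]_2 :=
  foldr (fun x M => lmx x *m M) 1%:M w.

Lemma mx2P (S : Type) (M N : 'M[S]_2) :
  M 0 0 = N 0 0 -> M 0 1 = N 0 1 -> M 1 0 = N 1 0 -> M 1 1 = N 1 1 -> M = N.
Proof.
move=> e00 e01 e10 e11; have o2 (i : 'I_2) : i = 0 \/ i = 1.
  by case: i => [[|[|//]] ?]; [left|right]; apply: val_inj.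
by apply/matrixP => i j; case: (o2 i) => ->; case: (o2 j) => ->.
Qed.

Lemma sum_ord2 (V : nmodType) (E : 'I_2 -> V) : \sum_k E k = E 0 + E 1.
Proof.
by rewrite !big_ord_recl big_ord0 addr0; congr (_ + E _); apply: val_inj.
Qed.

Lemma lmx_linv x : lmx x *m lmx (linv x) = 1%:M.
Proof.
rewrite /lmx /point linvK; case: x => a b.
apply: mx2P; rewrite !mxE sum_ord2 !mxE /=; case: b => /=; rewrite ?addn0 ?addn1; ring.
Qed.

Lemma wmx_cat u v : wmx (u ++ v) = wmx u *m wmx v.
Proof. by elim: u => [|x u IHu] /=; rewrite ?mul1mx // IHu mulmxA. Qed.

Lemma wmx_red_cat u v : wmx (red_cat u v) = wmx u *m wmx v.
Proof.
elim: u => [|x u IHu] /=; first by rewrite mul1mx.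
rewrite -mulmxA -IHu; case: (red_cat u v) => [|y w] //=.
by case: eqP => [->|//]; rewrite mulmxA lmx_linv mul1mx.
Qed.

(** The adjugate, which inverts matrices of determinant 1. It shows that the
    inverse of a generator has the same entries as the generator up to sign. *)
Definition adj2 (N : 'M[{poly rat}]_2) : 'M[{poly rat}]_2 :=
  \matrix_(i, j) (if i == 0 then if j == 0 then N 1 1 else - N 0 1
                  else if j == 0 then - N 1 0 else N 0 0).

Lemma adj2_mul M N : adj2 (M *m N) = adj2 N *m adj2 M.
Proof.
by apply: mx2P; rewrite !mxE !sum_ord2 !mxE /=; ring.
Qed.

Lemma adj2_lmx x : adj2 (lmx x) = lmx (linv x).
Proof.
rewrite /lmx /point linvK; case: x => a b.
by apply: mx2P; rewrite !mxE /=; case: b => /=; ring.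
Qed.

Lemma wmx_winv w : wmx (winv w) = adj2 (wmx w).
Proof.
elim: w => [|x w IHw] /=; first by apply: mx2P; rewrite !mxE //= oppr0.
rewrite /winv /= rev_cons -cats1 wmx_cat -/(winv w) IHw /= mulmx1.
by rewrite adj2_mul adj2_lmx.
Qed.

(** The coefficient of ['X] in the entries of [lmx x]. *)
Definition top_coef (x : letter A) (i j : 'I_2) : rat :=
  (-1) ^+ x.2 * (if i == 0 then 1 else (point x)%:R) *
  (if j == 0 then - (point (linv x))%:R else 1).

Lemma coef_lmx x : exists c0 : 'I_2 -> 'I_2 -> rat, forall (M : 'M[{poly rat}]_2) i j m,
  ((lmx x *m M) i j)`_m.+1 =
  \sum_k (top_coef x i k * (M k j)`_m + c0 i k * (M k j)`_m.+1).
Proof.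
pose p : rat := (point x)%:R; pose q : rat := (point (linv x))%:R.
pose c0 (i j : 'I_2) : rat := (-1) ^+ x.2 *
  (if i == 0 then if j == 0 then p + q else - 2
   else if j == 0 then p ^+ 2 + q ^+ 2 else - (p + q)).
exists c0 => M i j m; rewrite mxE coef_sum; apply: eq_bigr => k _.
rewrite (_ : lmx x i k = (top_coef x i k)%:P * 'X + (c0 i k)%:P).
  by rewrite mulrDl -mulrA coefD !coefCM coefXM.
rewrite /lmx /top_coef /c0 /p /q !mxE.
by do 2![case: (_ == _)]; rewrite !(rmorphM, rmorphD, rmorphN, rmorphXn, rmorph_nat,
  rmorph1, rmorphN1) /=; ring.
Qed.

Lemma size_wmx w i j : (size (wmx w i j) <= (size w).+1)%N.
Proof.
elim: w i => [|x w IHw] i /=.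
  by rewrite mxE; case: (i == j); rewrite ?size_poly1 ?size_poly0.
apply/leq_sizeP => -[|m] //; rewrite ltnS => lem.
have [c0 ->] := coef_lmx x; rewrite big1 // => k _.
by rewrite !nth_default ?mulr0 ?addr0 // (leq_trans (IHw k)) // ltnW.
Qed.

(** The leading matrix of a reduced word is a product of matrices of rank 1, the
    image of each being off the kernel of the previous one, hence not 0. Its
    first row is not 0 since its image is spanned by a vector [(1, p)].
    Asking [pos] to be injective on [s] only makes room for alphabets of any
    cardinality, since a tuple of words involves finitely many letters. *)
Lemma degree_wmx (s : seq A) w : {in s &, injective pos} ->
  reduced w -> all (fun x => x.1 \in s) w ->
  exists j, size (wmx w 0 j) = (size w).+1.
Proof.
move=> inj_pos; case: w => [_ _|x w]; first by exists 0; rewrite mxE eqxx size_poly1.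
move=> rw sw; suff [j cj] : exists j, (wmx (x :: w) 0 j)`_(size w).+1 != 0.
  exists j; apply/eqP; rewrite eqn_leq size_wmx ltnNge /=.
  by apply: contra cj => sz; rewrite nth_default.
have step x' w' i j : (wmx (x' :: w') i j)`_(size w').+1 =
    (-1) ^+ x'.2 * (if i == 0 then 1 else (point x')%:R) *
    ((wmx w' 1 j)`_(size w') - (point (linv x'))%:R * (wmx w' 0 j)`_(size w')).
  have [c0 /= ->] := coef_lmx x'; rewrite sum_ord2 /top_coef /=.
  rewrite ![_`_(size w').+1]nth_default ?size_wmx //; rewrite !mulr0 !addr0 mulr1.
  by move: (_ * (if _ then _ else _)) => T; rewrite -mulrA -mulrDr addrC mulNr.
elim: w x rw sw => [|y w IHw] x /=.
  move=> _ _; exists 1; have /= -> := step x [::] 0 1; rewrite !mxE !coefC /=.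
  by rewrite mulr0 subr0 !mulr1 signr_eq0.
move=> /andP[nyx rw] /and3P[xs ys sw]; have [|j cj] := IHw y rw; first by rewrite /= ys.
exists j; have /= -> := step x (y :: w) 0 j; rewrite mulr1.
have -> : (wmx (y :: w) 1 j)`_(size w).+1 = (point y)%:R * (wmx (y :: w) 0 j)`_(size w).+1.
  by rewrite !step /=; ring.
rewrite -mulrBl !mulf_neq0 ?signr_eq0 // subr_eq0 eqr_nat /=.
apply: contra nyx => /eqP; rewrite /point /=.
case: x y {IHw cj rw sw step} xs ys => a b [a' b'] /= xs ys e.
have ebb : b' = ~~ b by lia.
have/(inj_pos _ _ ys xs) -> : pos a' = pos a by lia.
by rewrite ebb.
Qed.

End LetterMatrices.

Section LettersIn.
Variables (A : choiceType) (s : seq A).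

Definition letters_in (w : seq (letter A)) := all (fun x => x.1 \in s) w.

Lemma letters_in_red_cat u v : letters_in u -> letters_in v -> letters_in (red_cat u v).
Proof.
move=> + sv; elim: u => //= x u IHu /andP[sx /IHu].
by case: (red_cat u v) => [|y w] /=; [rewrite sx | case: eqP => [_ /andP[]|_ /= ->]; rewrite ?sx].
Qed.

Lemma letters_in_winv w : letters_in w -> letters_in (winv w).
Proof. by rewrite /letters_in /winv all_rev all_map. Qed.

End LettersIn.

(** A bound [N] that depends only on [k] and on the lengths of the words [w j], and
    not on the free group in which they are evaluated, leaves finitely many
    possible relations when the free group varies. *)
Lemma length_relation (k D : nat) : exists N : nat,
  forall (A : choiceType) (h : 'I_k -> free_group A)
    (w : 'I_(k * 4).+1 -> free_group 'I_k),
  (forall j, word_length (w j) <= D)%N ->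
  exists e e' : {ffun 'I_(k * 4).+1 -> 'I_N.+1}, e != e' /\
    (\sum_j e j * word_length (fg_lift h (w j)) =
     \sum_j e' j * word_length (fg_lift h (w j)))%N.
Proof.
pose C : finType := ('I_k * 'I_2 * 'I_2)%type.
pose J : finType := 'I_(k * 4).+1.
exists ((D * #|J|).+1 ^ #|C|)%N => A h w wD.
(* The letters of the [h i], numbered by their rank in [s]. *)
pose s := flatten [seq [seq x.1 | x <- fg_word (h i)] | i <- enum 'I_k].
pose pos a := index a s.
have inj_pos : {in s &, injective pos}.
  by move=> a b sa sb e; rewrite -(nth_index a sa) -[RHS](nth_index a sb) -/(pos a) e.
pose M (g : free_group A) := wmx pos (fg_word g).
pose y (c : C) := M (h c.1.1) c.1.2 c.2.
have hs i : letters_in s (fg_word (h i)).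
  apply/allP => x xi; apply/flattenP; exists [seq z.1 | z <- fg_word (h i)].
    by apply/mapP; exists i; rewrite // mem_enum.
  by apply/mapP; exists x.
have xs (x : letter 'I_k) : letters_in s (fg_word (eval_letter h x)).
  by rewrite /eval_letter; case: x.2 => //; exact: letters_in_winv.
have sx (x : letter 'I_k) i j : in_span y 1 (M (eval_letter h x) i j).
  have gen i' j' : in_span y 1 (M (h x.1) i' j') by exact: (in_span_gen y (x.1, i', j')).
  rewrite /eval_letter; case: x.2 => //.
  rewrite /M /= wmx_winv mxE -!/(M (h x.1)).
  by do 2![case: (_ == _)]; rewrite -?scaleN1r; first [exact: gen | exact: in_spanZ].
have key (u : seq (letter 'I_k)) : letters_in s (fg_word (\prod_(x <- u) eval_letter h x)%g) /\
    forall i j, in_span y (size u) (M (\prod_(x <- u) eval_letter h x)%g i j).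
  elim: u => [|x u [IH1 IH2]].
    rewrite big_nil; split=> // i j; rewrite /M /= mxE.
    by case: (i == j); [apply: in_span1 | apply: in_span0].
  rewrite big_cons; split; first exact: letters_in_red_cat.
  move=> i j; rewrite /M /= wmx_red_cat mxE; apply: in_span_sum => l _.
  by rewrite -[(size u).+1]add1n; apply: in_span_mul; [apply: sx | apply: IH2].
have /choice[c Ec] : forall j : J, exists c : 'I_2,
    size (M (fg_lift h (w j)) 0 c) = (word_length (fg_lift h (w j))).+1.
  move=> j; apply: degree_wmx inj_pos (fg_word_reduced _) _.
  by have [] := key (fg_word (w j)).
have z0 (j : J) : M (fg_lift h (w j)) 0 (c j) != 0 by rewrite -size_poly_gt0 Ec.
have sz (j : J) : in_span y D (M (fg_lift h (w j)) 0 (c j)).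
  apply: in_span_widen (wD j) _; have [_] := key (fg_word (w j)); exact.
have ltCJ : (#|C| < #|J|)%N by rewrite /C /J !card_prod !card_ord -mulnA.
have [e [e' [nee]]] := degree_relation ltCJ erefl sz z0.
by under eq_bigr => j _ do rewrite Ec; under [RHS]eq_bigr => j _ do rewrite Ec; exists e, e'.
Qed.

(** * Asymptotic signs along an ultrafilter *)

Section Lexicographic.
Variable R : realType.

(** Positivity of a vector for the lexicographic order, on sequences: unlike
    [lexvec R n] they can grow by one leading coordinate in an induction. *)
Fixpoint lexpos (v : seq R) : bool :=
  if v is a :: v' then (0 < a) || ((a == 0) && lexpos v') else false.

Lemma lexposP (v : seq R) : reflect
  (exists2 k, forall i, (i < k)%N -> v`_i = 0 & 0 < v`_k) (lexpos v).
Proof.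
elim: v => [|a v IHv] /=; first by right=> -[k _]; rewrite nth_nil ltxx.
apply: (iffP orP) => [[a0|/andP[/eqP-> /IHv[k kv k0]]]|[[|k] kv k0]].
- by exists 0%N.
- by exists k.+1 => // -[|i] //; rewrite ltnS => /kv.
- by left.
- have a0 : a = 0 := kv 0%N isT.
  right; rewrite a0 eqxx; apply/IHv; exists k => // i ik.
  exact: (kv i.+1).
Qed.

Lemma lexvec_gt0 n (v : seq R) : (size v <= n)%N ->
  (0 < (\row_(i < n) v`_i : lexvec R n)) = lexpos v.
Proof.
move=> vn; apply/lexvec_ltP/lexposP => [[k kv k0]|[k kv k0]].
  exists k => [i ik|]; last by move: k0; rewrite !mxE.
  by have := kv (Ordinal (ltn_trans ik (ltn_ord k))) ik; rewrite !mxE /= => <-.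
have kn : (k < n)%N.
  by rewrite ltnNge; apply/negP => nk; rewrite nth_default ?ltxx // in k0; apply: leq_trans nk.
by exists (Ordinal kn) => [i ik|]; rewrite !mxE // kv.
Qed.

End Lexicographic.

Lemma lexvec_coordMz (R : realType) n (v : lexvec R n) (z : int) k :
  ((v *~ z : lexvec R n) : 'rV_n) ord0 k = (v : 'rV_n) ord0 k *~ z.
Proof.
have nat_case (m : nat) : ((v *+ m : lexvec R n) : 'rV_n) ord0 k = (v : 'rV_n) ord0 k *+ m.
  by elim: m => [|m IHm]; rewrite ?mulr0n ?mxE // !mulrS mxE IHm.
by case: z => m; rewrite -?mulrz_nat /intmul ?mxE nat_case.
Qed.

Section Ultrafilter.
Variables (R : realType) (T : Type) (U : set_system T).
Hypothesis ultraU : UltraFilter U.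
Local Open Scope classical_set_scope.

Lemma ultraN (P : T -> Prop) : ~ (\forall i \near U, P i) -> \forall i \near U, ~ P i.
Proof. by case: (in_ultra_setVsetC [set i | P i] ultraU). Qed.

Lemma ultra_absurd (P : T -> Prop) : (\forall i \near U, P i) ->
  (\forall i \near U, ~ P i) -> False.
Proof.
by move=> h1 h2; have [i [Pi nPi]] := filter_ex (filterI h1 h2).
Qed.

Lemma ultra_exists (I : finType) (P : I -> T -> Prop) :
  (\forall i \near U, exists j, P j i) -> exists j, \forall i \near U, P j i.
Proof.
move=> ex; apply: contrapT => nex.
have nP : \forall i \near U, forall j, ~ P j i.
  by apply: filter_forall => j; apply: ultraN => Pj; apply: nex; exists j.
by apply: (ultra_absurd ex); apply: filterS nP => i nP [j /nP].
Qed.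

(** A cluster point along an ultrafilter is a limit, and segments are compact. *)
Lemma ultra_limit (c : T -> R) : (\forall i \near U, -1 <= c i <= 1) ->
  exists u : R, c i @[i --> U] --> u.
Proof.
move=> c1; have cI : (c @ U) `[-1, 1]%classic.
  by rewrite /= /fmap /=; apply: filterS c1 => i; rewrite /= in_itv.
have [u [_ cu]] := segment_compact _ cI.
exists u => B uB; have [//|nB] := in_ultra_setVsetC (c @^-1` B) ultraU.
by have [x [nBx Bx]] := cu (~` B) B nB uB.
Qed.

(** Induction on the number of indices [j] for which [b^~ j] does not vanish.
    Some [b^~ j] is the largest in absolute value along [U]; after division by
    [`|b i j|] all coordinates are bounded and converge to a vector [u] along [U].
    A linear form that does not vanish at [u] has the sign of its value there.
    On the forms that vanish at [u], [b] may be replaced by [b - `|b i j| * u],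
    whose [j]-th coordinate vanishes along [U]. *)
Lemma ultra_sign (r : nat) (b : T -> 'I_r -> R) (S : {set 'I_r}) :
  (forall j, j \notin S -> \forall i \near U, b i j = 0) ->
  exists us : seq ('I_r -> R), forall x : 'I_r -> R,
    (\forall i \near U, 0 < \sum_j x j * b i j) <->
    lexpos [seq \sum_j x j * u j | u <- us].
Proof.
have [m] := ubnP #|S|; elim: m => // m IHm in S b *; rewrite ltnS => leSm bS.
have [b0|/ultraN nb0] := pselect (\forall i \near U, forall j, b i j = 0).
  exists [::] => x; split=> // pos; exfalso; apply: ultra_absurd pos _.
  by apply: filterS b0 => i b0; rewrite big1 ?ltxx // => j _; rewrite b0 mulr0.
have [j ppos] : exists j, \forall i \near U,
    0 < `|b i j| /\ forall l, `|b i l| <= `|b i j|.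
  apply: ultra_exists; apply: filterS nb0 => i /existsNP[j0 /eqP bj0].
  pose j := [arg max_(j > j0) `|b i j|]%O.
  have jmax l : `|b i l| <= `|b i j| by rewrite /j; case: arg_maxP => // k _; apply.
  by exists j; split=> //; apply: lt_le_trans (jmax j0); rewrite normr_gt0.
have jS : j \in S.
  apply: contraT => /bS bj; exfalso; apply: ultra_absurd bj _.
  by apply: filterS ppos => i [+ _] b0; rewrite b0 normr0 ltxx.
pose c i l := b i l / `|b i j|.
have /choice[u cu] : forall l, exists ul : R, c i l @[i --> U] --> ul.
  move=> l; apply: ultra_limit; apply: filterS ppos => i [bj bl].
  by rewrite -ler_norml normrM normfV normr_id ler_pdivrMr // mul1r.
pose b' i l := b i l - `|b i j| * u l.
have u1 : \forall i \near U, b i j = `|b i j| * u j.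
  (* Along [U] the sign of [b i j] is constant, and [c i j] is that sign. *)
  have [sgn|/ultraN sgn] := pselect (\forall i \near U, 0 < b i j).
    suff -> : u j = 1 by apply: filterS sgn => i bj; rewrite mulr1 gtr0_norm.
    apply: norm_cvg_unique (cu j) _; apply: cvg_near_cst.
    by apply: filterS sgn => i bj; rewrite /c gtr0_norm // divff // gt_eqF.
  have neg : \forall i \near U, b i j < 0.
    apply: filterS2 ppos sgn => i [+ _] /negP.
    by rewrite -leNgt le_eqVlt normr_gt0 => /negPf->.
  suff -> : u j = -1 by apply: filterS neg => i bj; rewrite mulrN1 ltr0_norm ?opprK.
  apply: norm_cvg_unique (cu j) _; apply: cvg_near_cst.
  by apply: filterS neg => i bj; rewrite /c ltr0_norm // invrN mulrN divff // lt_eqF.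
have [] := IHm (S :\ j) b'.
- by move: leSm; rewrite (cardsD1 j) jS.
- move=> l; rewrite !inE negb_and negbK => /orP[/eqP->|lS].
    by apply: filterS u1 => i e; rewrite /b' -e subrr.
  have ul : u l = 0.
    apply: norm_cvg_unique (cu l) _; apply: cvg_near_cst.
    by apply: filterS (bS l lS) => i e; rewrite /c e mul0r.
  by apply: filterS (bS l lS) => i e; rewrite /b' e ul mulr0 subrr.
move=> us Hus; exists (u :: us) => x /=; set a := \sum_l x l * u l.
have cvg_a : \sum_l x l * c i l @[i --> U] --> a.
  by apply: cvg_big => [|l _]; [exact: add_continuous | exact: cvgMl_tmp].
have sumE : \forall i \near U, \sum_l x l * b i l = `|b i j| * \sum_l x l * c i l.
  apply: filterS ppos => i [bj _]; rewrite mulr_sumr; apply: eq_bigr => l _.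
  by rewrite /c; field; rewrite gt_eqF.
case: (ltrgt0P a) => [a0|a0|a0] /=.
- split=> // _; apply: filterS3 ppos sumE (cvgr_gt _ cvg_a _ a0) => i [bj _] -> pos.
  exact: mulr_gt0.
- split=> // pos; exfalso; apply: ultra_absurd pos _.
  apply: filterS3 ppos sumE (cvgr_lt _ cvg_a _ a0) => i [bj _] -> neg.
  by apply/negP; rewrite -leNgt; apply/ltW; rewrite pmulr_rlt0.
rewrite -Hus; have e i : \sum_l x l * b' i l = \sum_l x l * b i l.
  under eq_bigr => l _ do rewrite mulrBr mulrCA.
  by rewrite sumrB -mulr_sumr -/a a0 mulr0 subr0.
by under eq_near => i do rewrite -e.
Qed.

Definition ultra_dependent (W : Type) (f : W -> T -> R) (r : nat) (w : 'I_r -> W) :=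
  exists2 c : 'I_r -> R, exists j, c j <> 0 &
    \forall i \near U, \sum_j c j * f (w j) i = 0.

(** A family that cannot be extended without becoming dependent spans, and the
    hypothesis bounds the size of the independent families. *)
Lemma ultra_spanning (W : Type) (f : W -> T -> R) (m : nat) :
  (forall w : 'I_m -> W, ultra_dependent f w) ->
  exists r (w : 'I_r -> W), forall w0, exists x : 'I_r -> R,
    \forall i \near U, f w0 i = \sum_j x j * f (w j) i.
Proof.
move=> dep; apply: contrapT => nspan.
suff /(_ m)[w nd] : forall r, exists w : 'I_r -> W, ~ ultra_dependent f w by apply: nd.
elim=> [|r [w nd]].
  case: (pselect (inhabited W)) => [[w0]|nW]; first by exists (fun=> w0) => -[c [[]]].
  exfalso; apply: nspan; exists 0%N.
  have w : 'I_0 -> W by case.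
  by exists w => w0; case: nW.
have [w0 nw0] : exists w0, ~ exists x : 'I_r -> R,
    \forall i \near U, f w0 i = \sum_j x j * f (w j) i.
  by apply/existsNP => sp; apply: nspan; exists r, w.
exists (fun j => if unlift ord0 j is Some j' then w j' else w0) => -[c [j cj] rel].
have {}rel : \forall i \near U, c ord0 * f w0 i + \sum_j c (lift ord0 j) * f (w j) i = 0.
  apply: filterS rel => i; rewrite big_ord_recl unlift_none.
  by under eq_bigr => l _ do rewrite liftK.
have [c0|/eqP c0] := pselect (c ord0 = 0).
  apply: nd; exists (fun j => c (lift ord0 j)).
    by move: cj; case: (unliftP ord0 j) => [j' ->|-> //]; exists j'.
  by apply: filterS rel => i; rewrite c0 mul0r add0r.
apply: nw0; exists (fun j => - c (lift ord0 j) / c ord0).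
apply: filterS rel => i /eqP; rewrite addrC addr_eq0 => /eqP e.
apply: (mulfI c0); rewrite -[LHS]opprK -e mulr_sumr -sumrN.
by apply: eq_bigr => l _; field.
Qed.

(** The coordinates of each [f w] in a finite spanning family turn integer
    combinations of the [f w] into linear forms, whose signs along [U] are given
    by [ultra_sign]. *)
Lemma lex_embedding (W : Type) (f : W -> T -> R) (m : nat) :
  (forall w : 'I_m -> W, ultra_dependent f w) ->
  exists2 n, (0 < n)%N & exists Phi : W -> lexvec R n, forall s : seq (int * W),
    (\forall i \near U, 0 < \sum_(p <- s) f p.2 i *~ p.1) <->
    0 < \sum_(p <- s) Phi p.2 *~ p.1.
Proof.
case/ultra_spanning => r [w /choice[x fx]].
have [|us Hus] := @ultra_sign _ (fun i j => f (w j) i) [set: 'I_r]%SET.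
  by move=> j; rewrite inE.
(* One coordinate more than needed, always 0, keeps the dimension positive. *)
exists (size us).+1 => //.
pose Psi (y : 'I_r -> R) : lexvec R (size us).+1 :=
  \row_(k < (size us).+1) [seq \sum_j y j * u j | u <- us]`_k.
have PsiD y y' : Psi (fun j => y j + y' j) = Psi y + Psi y'.
  apply/rowP => k; rewrite !mxE; have [kus|kus] := ltnP k (size us); last first.
    by rewrite !nth_default ?size_map // addr0.
  rewrite !(nth_map (fun=> 0)) // -big_split; apply: eq_bigr => j _.
  by rewrite mulrDl.
have PsiZ y (z : int) : Psi (fun j => y j *~ z) = Psi y *~ z.
  apply/rowP => k; rewrite lexvec_coordMz !mxE.
  have [kus|kus] := ltnP k (size us); last first.
    by rewrite !nth_default ?size_map // mul0rz.
  rewrite !(nth_map (fun=> 0)) // mulrz_suml; apply: eq_bigr => j _.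
  by rewrite mulrzAl.
have Psi0 : Psi (fun=> 0) = 0 by rewrite -[RHS](mulr0z (Psi (fun=> 0))) -PsiZ.
exists (fun w0 => Psi (x w0)) => s.
pose y (s : seq (int * W)) j := \sum_(p <- s) x p.2 j *~ p.1.
have PsiE : \sum_(p <- s) Psi (x p.2) *~ p.1 = Psi (y s).
  elim: s => [|p s IHs].
    by rewrite big_nil -Psi0; congr Psi; apply/funext => j; rewrite /y big_nil.
  rewrite big_cons IHs -PsiZ -PsiD; congr Psi; apply/funext => j.
  by rewrite /y big_cons.
rewrite PsiE lexvec_gt0 ?size_map // -Hus.
have E : \forall i \near U,
    \sum_(p <- s) f p.2 i *~ p.1 = \sum_j y s j * f (w j) i.
  elim: s {PsiE} => [|p s IHs].
    apply: filterE => i; rewrite big_nil big1 // => j _.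
    by rewrite /y big_nil mul0r.
  apply: filterS2 IHs (fx p.2) => i IHs fp; rewrite big_cons IHs fp mulrz_suml -big_split.
  by apply: eq_bigr => j _; rewrite /y big_cons mulrDl mulrzAl.
split=> pos; apply: filterS2 E pos => i e.
  by rewrite e.
by rewrite -e.
Qed.

End Ultrafilter.

(** * Limits of free groups *)

Section LiftComposition.
Local Open Scope group_scope.

Lemma fg_lift_comp (A B : choiceType) (G : groupType) (b : B -> G)
    (h : A -> free_group B) (w : free_group A) :
  fg_lift b (fg_lift h w) = fg_lift (fun a => fg_lift b (h a)) w.
Proof.
rewrite {2 3}/fg_lift; elim: (fg_word w) => [|x u IHu]; first by rewrite !big_nil fg_lift1.
rewrite !big_cons fg_lift_mul IHu; congr (_ * _).
by rewrite /eval_letter; case: x.2;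
  rewrite // -[RHS]mul1g -(fg_lift1 b) -(mulVg (h x.1)) fg_lift_mul -mulgA mulgV mulg1.
Qed.

(** Inverting a basis of [Y] replaces it, for questions about relations, by a
    tuple of elements in a group of reduced words, where lengths are defined. *)
Lemma free_marked_relations (k : nat) (Y : marked_group k) :
  is_free_group (carrier Y) ->
  exists (A : choiceType) (h : 'I_k -> free_group A), forall w,
    relation_of Y w <-> fg_lift h w = 1.
Proof.
case=> A [b [f fK Kf]]; exists A, (fun j => f (@marking _ Y j)) => w.
have e : fg_lift b (fg_lift (fun j => f (@marking _ Y j)) w) = fg_lift (@marking _ Y) w.
  by rewrite fg_lift_comp; congr fg_lift; apply/funext => j.
rewrite /relation_of -e; split=> [e1|->]; last by rewrite fg_lift1.
by rewrite -[LHS]fK e1 -(fg_lift1 b) fK.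
Qed.

End LiftComposition.

Section Limit.
Variables (R : realType) (G : groupType) (k : nat) (s : 'I_k -> G).
Variables (rep : G -> free_group 'I_k) (A : nat -> choiceType).
Variables (h : forall i, 'I_k -> free_group (A i)) (U : set_system nat).
Hypothesis repK : forall g, fg_lift s (rep g) = g.
Hypothesis ultraU : UltraFilter U.
Hypothesis hU : forall w, \forall i \near U,
  fg_lift (h i) w = 1%g <-> fg_lift s w = 1%g.

Let rho i (g : G) : free_group (A i) := fg_lift (h i) (rep g).
Let ell (w : free_group 'I_k) (i : nat) : R := (word_length (fg_lift (h i) w))%:R.

Lemma fg_lift_near w w' : fg_lift s w = fg_lift s w' ->
  \forall i \near U, fg_lift (h i) w = fg_lift (h i) w'.
Proof.
move=> e; apply: filterS (hU (w * w'^-1)%g) => i [_ H].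
have lift_inv (B : groupType) (t : 'I_k -> B) : fg_lift t (w'^-1)%g = ((fg_lift t w')^-1)%g.
  by apply: (mulgI (fg_lift t w')); rewrite -fg_lift_mul !mulgV fg_lift1.
have : fg_lift (h i) (w * w'^-1)%g = 1%g by apply: H; rewrite fg_lift_mul lift_inv e mulgV.
rewrite fg_lift_mul lift_inv => /(congr1 (fun g => g * fg_lift (h i) w')%g).
by rewrite -mulgA mulVg mulg1 mul1g.
Qed.

Lemma rho_mulV x y : \forall i \near U, rho i (x^-1 * y)%g = ((rho i x)^-1 * rho i y)%g.
Proof.
have e : fg_lift s (rep (x^-1 * y)%g) = fg_lift s ((rep x)^-1 * rep y)%g.
  apply: (mulgI x); rewrite repK mulgA mulgV mul1g -{1}[x]repK -fg_lift_mul.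
  by rewrite mulgA mulgV mul1g repK.
apply: filterS (fg_lift_near e) => i; rewrite /rho => ->.
by apply: (mulgI (fg_lift (h i) (rep x))); rewrite -fg_lift_mul !mulgA !mulgV !mul1g.
Qed.

(** Each [i] yields one of finitely many relations; the ultrafilter selects one
    that holds for almost all [i]. *)
Lemma ell_dependent (w : 'I_(k * 4).+1 -> free_group 'I_k) : ultra_dependent U ell w.
Proof.
pose D := \max_j word_length (w j); have [N HN] := length_relation k D.
have [|[e e'] near_e] := @ultra_exists _ _ ultraU
    ({ffun 'I_(k * 4).+1 -> 'I_N.+1} * {ffun 'I_(k * 4).+1 -> 'I_N.+1})%type
    (fun p i => p.1 != p.2 /\ (\sum_j p.1 j * word_length (fg_lift (h i) (w j)) =
     \sum_j p.2 j * word_length (fg_lift (h i) (w j)))%N).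
  apply: filterE => i; have [|e [e' ee']] := HN _ (h i) w; last by exists (e, e').
  by move=> j; apply: leq_bigmax.
have [i0 [/= nee _]] := filter_ex near_e.
exists (fun j => (e j)%:R - (e' j)%:R).
  have [j nej] : exists j, e j != e' j.
    by apply/existsP; rewrite -negb_forall; apply: contra nee => /forallP ee;
       apply/eqP/ffunP => j; apply/eqP.
  by exists j => /eqP; rewrite subr_eq0 eqr_nat; apply/negP.
apply: filterS near_e => i [_ /= /(congr1 (fun n => n%:R : R))].
rewrite !natr_sum => /eqP; rewrite -subr_eq0 -sumrB => /eqP e0.
rewrite -[RHS]e0; apply: eq_bigr => j _.
by rewrite !natrM mulrBl.
Qed.

Variables (n : nat) (Phi : free_group 'I_k -> lexvec R n).
Hypothesis PhiP : forall c : seq (int * free_group 'I_k),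
  (\forall i \near U, 0 < \sum_(p <- c) ell p.2 i *~ p.1) <->
  0 < \sum_(p <- c) Phi p.2 *~ p.1.

Let d (x y : G) : lexvec R n := Phi (rep (x^-1 * y)%g).

Lemma Phi_le (c : seq (int * free_group 'I_k)) :
  (\forall i \near U, \sum_(p <- c) ell p.2 i *~ p.1 <= 0) ->
  \sum_(p <- c) Phi p.2 *~ p.1 <= 0.
Proof.
move=> le0; rewrite leNgt; apply/negP => /PhiP pos.
apply: (ultra_absurd ultraU pos).
by apply: filterS le0 => i le0; apply/negP; rewrite -leNgt.
Qed.

Lemma Phi_le2 w1 w2 : (\forall i \near U, ell w1 i <= ell w2 i) -> Phi w1 <= Phi w2.
Proof.
move=> le12; have := @Phi_le [:: (1, w1); (-1, w2)]; rewrite !big_cons !big_nil /=.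
rewrite mulr1z mulrN1z addr0 => H.
apply: (lex_le1 (x1 := Phi w1 - Phi w2) (y1 := 0)); first by lexring.
apply: H; apply: filterS le12 => i le12.
by rewrite !big_cons !big_nil /= mulr1z mulrN1z addr0 subr_le0.
Qed.

(** The sign of an integer combination of values of [Phi] is the sign along [U]
    of the same combination of word lengths, so the axioms hold because they hold
    in each free group. *)
Lemma limit_zero_hyperbolic : zero_hyperbolic d.
Proof.
have ell_d x y : \forall i \near U,
    ell (rep (x^-1 * y)%g) i = (word_length ((rho i x)^-1 * rho i y)%g)%:R.
  by apply: filterS (rho_mulV x y) => i e; rewrite /ell -/(rho i _) e.
split=> [x|x y|x y u v].
- have : \forall i \near U, ell (rep (x^-1 * x)%g) i = 0.
    by apply: filterS (ell_d x x) => i ->; rewrite mulVg.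
  move=> e0; apply/le_anti/andP; split.
    have := @Phi_le [:: (1, rep (x^-1 * x)%g)]; rewrite big_seq1 /= mulr1z; apply.
    by apply: filterS e0 => i e0; rewrite big_seq1 /= e0.
  have := @Phi_le [:: (-1, rep (x^-1 * x)%g)]; rewrite big_seq1 /= mulrN1z => H.
  apply: (lex_le1 (x1 := - d x x) (y1 := 0)); first by lexring.
  by apply: H; apply: filterS e0 => i e0; rewrite big_seq1 /= e0 mulrN1z oppr0.
- have e : \forall i \near U, ell (rep (x^-1 * y)%g) i = ell (rep (y^-1 * x)%g) i.
    apply: filterS2 (ell_d x y) (ell_d y x) => i -> ->.
    by rewrite -word_lengthV invgM invgK.
  by apply/le_anti/andP; split; apply: Phi_le2; apply: filterS e => i ->.
- have four : forall a b a' b' : free_group 'I_k,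
      (\forall i \near U, ell a i + ell b i <= ell a' i + ell b' i) ->
      Phi a + Phi b <= Phi a' + Phi b'.
    move=> a b a' b' le4.
    have := @Phi_le [:: (1, a); (1, b); (-1, a'); (-1, b')]; rewrite !big_cons !big_nil /=.
    rewrite !mulr1z !mulrN1z addr0 => H.
    apply: (lex_le1 (x1 := Phi a + (Phi b + (- Phi a' - Phi b'))) (y1 := 0)).
      by lexring.
    apply: H; apply: filterS le4 => i le4.
    by rewrite !big_cons !big_nil /= !mulr1z !mulrN1z addr0; lra.
  pose E (c : bool) i := if c
    then ell (rep (x^-1 * y)%g) i + ell (rep (u^-1 * v)%g) i <=
         ell (rep (x^-1 * u)%g) i + ell (rep (y^-1 * v)%g) i
    else ell (rep (x^-1 * y)%g) i + ell (rep (u^-1 * v)%g) i <=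
         ell (rep (x^-1 * v)%g) i + ell (rep (y^-1 * u)%g) i.
  have [|[] near_E] := @ultra_exists _ _ ultraU bool E; last 2 first.
  + by left; apply: four.
  + by right; apply: four.
  pose ellE i (x y : G) := ell (rep (x^-1 * y)%g) i =
    (word_length ((rho i x)^-1 * rho i y)%g)%:R.
  have ell_d2 (x1 y1 x2 y2 : G) : \forall i \near U, ellE i x1 y1 /\ ellE i x2 y2.
    by apply: filterS2 (ell_d x1 y1) (ell_d x2 y2).
  apply: filterS3 (ell_d2 x y u v) (ell_d2 x u y v) (ell_d2 x v y u).
  move=> i [exy euv] [exu eyv] [exv eyu].
  have [le4|le4] := word_length_four (rho i x) (rho i y) (rho i u) (rho i v).
    by exists true; rewrite /E exy euv exu eyv -!natrD ler_nat.
  by exists false; rewrite /E exy euv exv eyu -!natrD ler_nat.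
Qed.

(** As [rep g] is not a relation of the limit, [rho i g] is not 1 for almost all
    [i], and [word_length_square] applies to it. *)
Lemma limit_hyperbolic_action g : g <> 1%g -> d 1%g g < d 1%g (g * g)%g.
Proof.
move=> g1; rewrite ltNge; apply/negP => le_gg.
have [] := PhiP [:: (1, rep (g * g)%g); (-1, rep g)].
rewrite !big_cons !big_nil /= mulr1z mulrN1z addr0 => pos _.
have {pos} : 0 < Phi (rep (g * g)%g) - Phi (rep g).
  apply: pos; have rho_g : \forall i \near U, rho i g <> 1%g.
    by apply: filterS (hU (rep g)) => i [H _] /H; rewrite repK.
  have rho_gg : \forall i \near U, rho i (g * g)%g = (rho i g * rho i g)%g.
    rewrite /rho; have e : fg_lift s (rep (g * g)%g) = fg_lift s (rep g * rep g)%g.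
      by rewrite fg_lift_mul !repK.
    by apply: filterS (fg_lift_near e) => i ->; rewrite fg_lift_mul.
  apply: filterS2 rho_g rho_gg => i /word_length_square lt_g e.
  rewrite !big_cons !big_nil /= mulr1z mulrN1z addr0 subr_gt0.
  by rewrite /ell -!/(rho i _) e ltr_nat.
rewrite ltNge => /negP; apply.
move: le_gg; rewrite /d invg1 !mul1g => le_gg.
by apply: (lex_le1 _ le_gg); lexring.
Qed.

End Limit.

Theorem corollary3p4 (R : realType) (G : groupType) :
  limit_group G ->
  exists (n : nat) (T : Type) (d : T -> T -> lexvec R n) (act : G -> T -> T),
    [/\ (0 < n)%N, lambda_tree d, isometric_action d act & free_action act].
Proof.
case=> k [s [gen_s [Y [freeY cvgY]]]].
have /choice[rep repK] := gen_s.
have /choice[Ah AhP] : forall i, exists Ah : {A : choiceType & 'I_k -> free_group A},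
    forall w, relation_of (Y i) w <-> fg_lift (projT2 Ah) w = 1%g.
  by move=> i; have [A [h hP]] := free_marked_relations (freeY i); exists (existT _ A h).
have [U [ultraU ooU]] := ultraFilterLemma (eventually_filter : ProperFilter _).
have hU w : \forall i \near U,
    fg_lift (projT2 (Ah i)) w = 1%g <-> fg_lift s w = 1%g.
  have [N HN] := cvgY (word_length w).+1 isT.
  apply: ooU; exists N => // i /= Ni; rewrite -AhP; exact: HN.
have [n n0 [Phi PhiP]] := lex_embedding ultraU (ell_dependent R (fun i => projT2 (Ah i)) ultraU).
have zh := limit_zero_hyperbolic repK ultraU hU PhiP.
have isom : isometric_action (fun x y : G => Phi (rep (x^-1 * y)%g)) (fun g x => g * x)%g.
  split=> [x|g h x|g x y]; [exact: mul1g | by rewrite mulgA |].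
  by rewrite invgM -mulgA (mulgA g^-1%g) mulVg mul1g.
exists n, (hull (fun x y : G => Phi (rep (x^-1 * y)%g))), (hull_metric zh 1%g), (hull_act isom).
split=> //; [exact: hull_tree | exact: hull_act_isometric |].
apply: hull_act_free zh _ _ => g g1; exists 1%g; rewrite !mulg1.
exact: (limit_hyperbolic_action repK ultraU hU PhiP).
Qed.
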